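(* Let $\mathbb{K}\in\{\mathbb{R},\mathbb{C}\}$, let $g,\delta,d,t\ge 1$ be integers, let $p$ be a noncommutative homogeneous polynomial of degree $\delta d$ in the noncommutative indeterminates $x=(x_1,\dots,x_g)$ with coefficients in $\mathbb{K}$, and let $\phi(p)$ be the noncommutative homogeneous polynomial of degree $d$ in the $g^\delta$ noncommutative indeterminates $\{z_\beta\}_{\beta\in S^g_\delta}$ obtained from $p$ by the substitution $x^\beta\mapsto z_\beta$ (defined in the context). Then: (1) $p(x)$ has a $t$-term $(\delta,d)$-noncommutative Waring decomposition over $\mathbb{K}$ if and only if $\phi(p(x))$ has a $t$-term $(1,d)$-noncommutative Waring decomposition over $\mathbb{K}$. (2) $p(x)$ satisfies the $\delta$-compatibility condition if and only if $\phi(p(x))$ satisfies the $1$-compatibility condition. (3) $p(x)$ has a $t$-term $(\delta,d)$-noncommutative Waring decomposition over $\mathbb{K}$ if and only if $p(x)$ satisfies the $\delta$-compatibility condition and the commutative collapse of $\phi(p(x))$ has a $t$-term $(1,d)$-Waring decomposition over $\mathbb{K}$.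
   Context: Noncommutative polynomials are elements of a free associative algebra over $\mathbb{K}$. $S^g_\delta=\{1,\dots,g\}^\delta$ is the set of $\delta$-tuples of integers between $1$ and $g$; for $\beta=(\beta^{(1)},\dots,\beta^{(\delta)})\in S^g_\delta$ write $x^\beta=x_{\beta^{(1)}}\cdots x_{\beta^{(\delta)}}$. $(S^g_\delta)^d$ is the set of $d$-tuples $\mu=(\mu_1,\dots,\mu_d)$ of elements of $S^g_\delta$, identified with $S^g_{\delta d}=\{1,\dots,g\}^{\delta d}$ by concatenation; $x^\mu=x^{\mu_1}x^{\mu_2}\cdots x^{\mu_d}$. Every noncommutative homogeneous polynomial of degree $\delta d$ is uniquely of the form $p(x)=\sum_{\mu\in(S^g_\delta)^d}P_\mu x^{\mu_1}\cdots x^{\mu_d}$. The map $\phi$: with $\{z_\beta\}_{\beta\in S^g_\delta}$ noncommutative indeterminates indexed by $S^g_\delta$, $$\phi(p(x))=\sum_{\mu\in(S^g_\delta)^d}P_\mu z_{\mu_1}z_{\mu_2}\cdots z_{\mu_d}.$$ A $t$-term $(\delta,d)$-noncommutative Waring decomposition of $p$ over $\mathbb{K}$ is an expression $p(x)=\sum_{s=1}^t\big(\sum_{\beta\in S^g_\delta}A^{(s)}_\beta x^\beta\big)^d$ with $A^{(s)}_\beta\in\mathbb{K}$. Thus a $t$-term $(1,d)$-noncommutative Waring decomposition of a noncommutative polynomial $q$ in the variables $z_\beta$ is an expression of $q$ as a sum of $t$ $d$-th powers of homogeneous linear forms $\sum_\beta A^{(s)}_\beta z_\beta$. A $t$-term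 $(1,d)$-Waring decomposition of a commutative polynomial is an expression as a sum of $t$ $d$-th powers of homogeneous linear forms in the commuting variables. The commutative collapse of a noncommutative polynomial is the commutative polynomial obtained by letting its variables commute. For $\mu\in(S^g_\delta)^d$ and $\beta\in S^g_\delta$, let $\mathbb{1}^\mu_\beta$ be the number of $k\in\{1,\dots,d\}$ with $\mu_k=\beta$. The $\delta$-compatibility condition for $p$: $P_\mu=P_{\tilde\mu}$ for all $\mu,\tilde\mu\in(S^g_\delta)^d$ with $\mathbb{1}^\mu_\beta=\mathbb{1}^{\tilde\mu}_\beta$ for all $\beta\in S^g_\delta$. The $1$-compatibility condition for a noncommutative homogeneous polynomial of degree $d$ in variables indexed by a finite set $I$: the coefficients of two monomials of degree $d$ are equal whenever each variable occurs the same number of times in both monomials. *)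

(* Defs.v *)
From HB Require Import structures.
From mathcomp Require Import all_boot all_order all_algebra.
From mathcomp Require Import finmap monalg.
From mathcomp Require Import complex.
From mathcomp Require Import reals.

Set Implicit Arguments.
Unset Strict Implicit.
Unset Printing Implicit Defensive.

Import GRing.Theory.
Local Open Scope ring_scope.

(* Monoid algebra of the free monoid on I: the free associative algebra. *)
Notation "{ 'ncpoly' K [ I ] }" := {malg K[{fmonom I}]}
  (at level 0, K, I at level 2, format "{ 'ncpoly'  K [ I ] }") : type_scope.

(* Monoid algebra of the free commutative monoid on I. *)
Notation "{ 'cpoly' K [ I ] }" := {malg K[{cmonom I}]}
  (at level 0, K, I at level 2, format "{ 'cpoly'  K [ I ] }") : type_scope.

Section NCPoly.
Variables (K : fieldType) (I : finType).
Implicit Types (delta d t : nat) (p : {ncpoly K[I]}) (q : {cpoly K[I]}).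

Definition ncX (i : I) : {ncpoly K[I]} := << fmu i >>.
Definition cX (i : I) : {cpoly K[I]} := << ucm i >>.

Definition ncmon (s : seq I) : {ncpoly K[I]} := \prod_(i <- s) ncX i.

(* As usual, 0 is homogeneous of every degree. *)
Definition nchomog (n : nat) p : Prop :=
  forall m : {fmonom I}, m \in msupp p -> fdeg m = n.

(* The index set S_delta is delta.-tuple I, and (S_delta)^d is
   d.-tuple (delta.-tuple I). *)
Definition concat delta d (mu : d.-tuple (delta.-tuple I)) : seq I :=
  flatten [seq val b | b <- mu].

Definition nccoef delta d p (mu : d.-tuple (delta.-tuple I)) : K :=
  p@_(FMonom (concat mu)).

Definition nc_waring delta d t p : Prop :=
  exists A : 'I_t -> delta.-tuple I -> K,
    p = \sum_(s < t) (\sum_(b : delta.-tuple I) A s b *: ncmon b) ^+ d.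

Definition compatible delta d p : Prop :=
  forall mu nu : d.-tuple (delta.-tuple I),
    (forall b : delta.-tuple I, count_mem b mu = count_mem b nu) ->
    nccoef p mu = nccoef p nu.

Definition c_waring d t q : Prop :=
  exists A : 'I_t -> I -> K,
    q = \sum_(s < t) (\sum_(i : I) A s i *: cX i) ^+ d.

Definition collapse p : {cpoly K[I]} :=
  \sum_(m <- msupp p) p@_m *: \prod_(i <- (m : seq I)) cX i.

End NCPoly.

(* The indeterminate z_b is ncX b, for b in the finite type
   delta.-tuple 'I_g. *)
Definition phi (K : fieldType) (g delta d : nat) (p : {ncpoly K['I_g]}) :
    {ncpoly K[delta.-tuple 'I_g]} :=
  \sum_(mu : d.-tuple (delta.-tuple 'I_g)) nccoef p mu *: ncmon K mu.

Section SanityChecks.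
Variables (K : fieldType) (I : finType).
Implicit Types (d t : nat) (p : {ncpoly K[I]}).

Lemma ncmonE (s : seq I) : ncmon K s = << FMonom s >>.
Proof.
elim: s => [|i s IHs]; rewrite /ncmon ?big_nil ?big_cons.
  by rewrite -fmoneE.
rewrite -/(ncmon K s) IHs /ncX malgME !msuppU oner_eq0 !big_seq_fset1.
by rewrite !mcoeffUU mulr1 fmuE; congr << _ >>; rewrite [LHS]fmmulE.
Qed.

Lemma tuple1_eta (b : 1.-tuple I) : [tuple thead b] = b.
Proof. by case/tupleP: b => i b; rewrite (tuple0 b); apply: val_inj. Qed.

Lemma nc_waring1P d t p :
  nc_waring 1 d t p <->
  exists A : 'I_t -> I -> K,
    p = \sum_(s < t) (\sum_(i : I) A s i *: ncX K i) ^+ d.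
Proof.
have reidx (A : 1.-tuple I -> K) :
    \sum_(b : 1.-tuple I) A b *: ncmon K b
    = \sum_(i : I) A [tuple i] *: ncX K i.
  rewrite (reindex (fun i : I => [tuple i])) /=.
    by apply: eq_bigr => i _; rewrite /ncmon big_seq1.
  exists (fun b : 1.-tuple I => thead b) => // b _.
  exact: tuple1_eta.
split=> -[A ->].
  by exists (fun s i => A s [tuple i]); apply: eq_bigr => s _; rewrite reidx.
exists (fun s b => A s (thead b)); apply: eq_bigr => s _.
by rewrite reidx.
Qed.

Lemma compatible1P d p :
  compatible 1 d p <->
  forall u v : d.-tuple I,
    (forall i, count_mem i u = count_mem i v) ->
    p@_(FMonom u) = p@_(FMonom v).
Proof.
have cnt (i : I) (b : 1.-tuple I) (w : d.-tuple (1.-tuple I)) :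
    b = [tuple i] -> count_mem b w = count_mem i (concat w).
  move=> ->; rewrite /concat; elim: (val w) => //= c s ->.
  rewrite count_cat; congr (_ + _)%N.
  by case/tupleP: c => j c; rewrite tuple0 /= addn0 -val_eqE /= eqseq_cons andbT.
have szc (w : d.-tuple (1.-tuple I)) : size (concat w) == d.
  rewrite /concat -[X in _ == X](size_tuple w) /=; elim: (val w) => //= c s.
  by rewrite size_cat size_tuple eqSS.
have lift (u : d.-tuple I) : concat [tuple of map (fun i => [tuple i]) u] = u.
  by rewrite /concat /=; elim: (val u) => //= i s ->.
split=> [Hc u v Huv|Hc mu nu Hmn].
  have := Hc [tuple of map (fun i => [tuple i]) u]
             [tuple of map (fun i => [tuple i]) v].
  rewrite /nccoef !lift; apply=> b.
  by rewrite !(cnt _ _ _ (esym (tuple1_eta b))) !lift.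
apply: (Hc (Tuple (szc mu)) (Tuple (szc nu))) => i /=.
by rewrite -!(cnt i [tuple i]).
Qed.

Lemma collapse_ncX (i : I) : collapse (ncX K i) = cX K i.
Proof.
rewrite /collapse /ncX msuppU oner_eq0 big_seq_fset1 mcoeffUU scale1r.
by rewrite fmuE big_seq1.
Qed.

End SanityChecks.

Lemma phi_ncmon (K : fieldType) (g delta d : nat)
    (mu : d.-tuple (delta.-tuple 'I_g)) :
  phi delta d (ncmon K (concat mu)) = ncmon K mu.
Proof.
have inj : injective (@concat 'I_g delta d).
  move=> u v E; apply: val_inj; apply: (inj_map val_inj).
  apply: eq_from_flatten_shape => //.
  have shE w : shape [seq val b | b <- (w : d.-tuple (delta.-tuple 'I_g))]
      = nseq d delta.
    rewrite -[in RHS](size_tuple w) /=; elim: (val w) => //= c s ->.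
    by rewrite size_tuple.
  by rewrite !shE.
rewrite /phi (bigD1 mu) //= big1 => [|nu ne]; rewrite /nccoef ncmonE mcoeffU.
  by rewrite eqxx scale1r addr0.
by rewrite fmP /= (inj_eq inj) eq_sym (negbTE ne) scale0r.
Qed.

(* Main.v *)
Require Import Defs.
From mathcomp Require Import all_boot all_order all_algebra.
From mathcomp Require Import finmap monalg complex reals.

(** Expanding the [d]-th powers, a Waring decomposition of [p] amounts to
  [P_mu = \sum_s \prod_k A^(s)_(mu_k)] for every [mu], and [phi] leaves the
  family [P_mu] unchanged; this gives (1) and (2).  The right-hand side is
  symmetric in [mu], hence compatibility is necessary.  Conversely, the
  coefficient of a commutative monomial in the collapse is the sum of [P_mu]
  over all rearrangements of [mu], that is, [P_mu] times the size of the
  rearrangement class, which can be cancelled in characteristic 0. *)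

Set Implicit Arguments.
Unset Strict Implicit.
Unset Printing Implicit Defensive.

Import GRing.Theory Num.Theory.
Local Open Scope ring_scope.

Section MonomialSums.
Variables (K : fieldType) (M : monomType).

Lemma scale_monom (c : K) (m : M) : c *: << m >> = << c *g m >> :> {malg K[M]}.
Proof. by apply/malgP => k; rewrite mcoeffZ !mcoeffU mulr_natr. Qed.

Lemma prod_monom (T : Type) (x : T -> M) (s : seq T) :
  \prod_(b <- s) << x b >> = << \big[mmul/mone]_(b <- s) x b >> :> {malg K[M]}.
Proof.
elim: s => [|b s IHs]; first by rewrite !big_nil.
by rewrite !big_cons IHs malgM_def fgmulUU mulr1.
Qed.

(** Stated over an arbitrary monoid of monomials, so that the same expansion serves words and
    commutative monomials. The terms are indexed by words [mu] of length [d]; the induction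
    identifies a word of length [d.+1] with its head and tail. *)
Lemma exp_sum_monom (T : finType) (x : T -> M) (A : T -> K) (d : nat) :
  (\sum_(b : T) A b *: << x b >>) ^+ d
  = \sum_(mu : d.-tuple T) (\prod_(b <- mu) A b)
      *: << \big[mmul/mone]_(b <- mu) x b >> :> {malg K[M]}.
Proof.
elim: d => [|d IHd].
  rewrite expr0 (big_pred1 [tuple]) => [|mu]; last exact/esym/eqP/tuple0.
  by rewrite /= !big_nil scale1r.
rewrite exprS IHd big_distrlr pair_bigA /=.
rewrite [RHS](reindex (fun u : T * d.-tuple T => [tuple of u.1 :: u.2])) /=.
  apply: eq_bigr => -[b mu] _ /=.
  by rewrite !big_cons !scale_monom malgM_def fgmulUU.
exists (fun mu => (thead mu, [tuple of behead mu])) => [[b mu]|mu] _ /=.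
  by congr pair; apply: val_inj.
by rewrite [RHS]tuple_eta.
Qed.

Lemma mcoeff_sum_monom (T : finType) (x : T -> M) (c : T -> K) (m : M) :
  (\sum_(b : T) c b *: << x b >> : {malg K[M]})@_m
  = \sum_(b : T | x b == m) c b.
Proof.
rewrite raddf_sum [RHS]big_mkcond; apply: eq_bigr => b _ /=.
by rewrite mcoeffZ mcoeffU; case: eqP => _; rewrite ?mulr1 ?mulr0.
Qed.

Lemma sum_monom_inj (T : finType) (x : T -> M) (c e : T -> K) :
  injective x ->
  \sum_b c b *: << x b >> = \sum_b e b *: << x b >> :> {malg K[M]} ->
  c =1 e.
Proof.
move=> x_inj E b; move/malgP/(_ (x b)): E; rewrite !mcoeff_sum_monom.
by rewrite !(big_pred1 b) // => b'; rewrite (inj_eq x_inj).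
Qed.

(** The coefficient at [x b] is a sum over the fibre of [x] through [b]. On it the coefficient
    family is constant, so the sum is its value at [b] times the size of the fibre, which is
    positive and hence invertible in characteristic 0. *)
Lemma sum_monom_fiber_inj (T : finType) (x : T -> M) (c e : T -> K) :
  [pchar K] =i pred0 ->
  (forall b b', x b = x b' -> c b = c b') ->
  (forall b b', x b = x b' -> e b = e b') ->
  \sum_b c b *: << x b >> = \sum_b e b *: << x b >> :> {malg K[M]} ->
  c =1 e.
Proof.
move=> K0 c_x e_x E b.
have fiber_sum (f : T -> K) : (forall b b', x b = x b' -> f b = f b') ->
    \sum_(b' | x b' == x b) f b' = f b *+ #|[pred b' | x b' == x b]|.
  by move=> f_x; rewrite -sumr_const; apply: eq_bigr => b' /eqP/f_x.
move/malgP/(_ (x b)): E; rewrite !mcoeff_sum_monom !fiber_sum //.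
rewrite -[c b *+ _]mulr_natr -[e b *+ _]mulr_natr.
apply: mulIf; rewrite (proj1 (pcharf0P K) K0).
by rewrite -lt0n; apply/card_gt0P; exists b; rewrite inE /=.
Qed.

End MonomialSums.

Section Monomials.
Variable I : finType.

Lemma big_mmul_fmonom (T : Type) (f : T -> seq I) (s : seq T) :
  \big[mmul/mone]_(b <- s) FMonom (f b) = FMonom (flatten (map f s)).
Proof.
elim: s => [|b s IHs]; first by rewrite big_nil -fmoneE.
by rewrite big_cons IHs [LHS]fmmulE.
Qed.

Lemma big_mmul_ucm (s : seq I) (i : I) :
  (\big[mmul/mone]_(b <- s) ucm b : {cmonom I}) i = count_mem i s.
Proof.
elim: s => [|b s IHs]; first by rewrite big_nil cm1.
by rewrite big_cons cmM IHs cmU.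
Qed.

(** A commutative monomial is determined by its exponents, and these count letters: the fibres of
    passing from words to commutative monomials are the rearrangement classes. *)
Lemma eq_big_mmul_ucm (s u : seq I) :
  (\big[mmul/mone]_(b <- s) ucm b == \big[mmul/mone]_(b <- u) ucm b)
  = perm_eq s u.
Proof.
apply/eqP/idP => [E|/permP E].
  by apply/allP => i _; rewrite /= -!big_mmul_ucm E.
by apply/eqP/cmP => i; rewrite !big_mmul_ucm E.
Qed.

(** All blocks have length [delta], so the concatenated word determines where it is cut. *)
Lemma concat_inj delta d : injective (@concat I delta d).
Proof.
move=> u v E; apply: val_inj; apply: (inj_map val_inj).
apply: eq_from_flatten_shape => //.
have shE (w : d.-tuple (delta.-tuple I)) : shape (map val w) = nseq d delta.
  rewrite -[in RHS](size_tuple w) /=; elim: (val w) => //= c s ->.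
  by rewrite size_tuple.
by rewrite !shE.
Qed.

Lemma concat_surj delta d (s : seq I) :
  size s = (delta * d)%N ->
  exists mu : d.-tuple (delta.-tuple I), concat mu = s.
Proof.
elim: d s => [|d IHd] s; first by rewrite muln0 => /size0nil ->; exists [tuple].
rewrite mulnS => sz.
have szt : size (take delta s) == delta by rewrite size_takel // sz leq_addr.
have [|mu Emu] := IHd (drop delta s); first by rewrite size_drop sz addKn.
exists [tuple of Tuple szt :: mu].
by rewrite /concat /= -/(concat mu) Emu cat_take_drop.
Qed.

End Monomials.

Section Waring.
Variables (K : fieldType) (I : finType).

Lemma homog_expansion delta d (p : {ncpoly K[I]}) : nchomog (delta * d) p ->
  p = \sum_(mu : d.-tuple (delta.-tuple I))
        nccoef p mu *: << FMonom (concat mu) >>.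
Proof.
move=> hp; apply/malgP => m; rewrite mcoeff_sum_monom.
have eqm (mu : d.-tuple (delta.-tuple I)) :
  (FMonom (concat mu) == m) = (concat mu == m) by rewrite fmP.
have [mp|mNp] := boolP (m \in msupp p).
  have [mu Emu] := concat_surj (hp m mp).
  rewrite (big_pred1 mu) => [|nu]; last first.
    by rewrite eqm -Emu (inj_eq (@concat_inj _ _ _)).
  by rewrite /nccoef Emu; congr (_@__); apply/eqP; rewrite fmP.
(* Outside the support the monomial may still be a concatenation, but its coefficient in [p] is then
   0. *)
rewrite mcoeff_outdom // big1 // => mu /eqP E.
by rewrite /nccoef E mcoeff_outdom.
Qed.

Lemma sum_exp_ncmon delta d t (A : 'I_t -> delta.-tuple I -> K) :
  \sum_(s < t) (\sum_(b : delta.-tuple I) A s b *: ncmon K b) ^+ d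
  = \sum_(mu : d.-tuple (delta.-tuple I))
      (\sum_(s < t) \prod_(b <- mu) A s b) *: << FMonom (concat mu) >>.
Proof.
under eq_bigr => s _ do
  (under eq_bigr => b _ do rewrite ncmonE; rewrite exp_sum_monom).
rewrite exchange_big; apply: eq_bigr => mu _ /=.
by rewrite scaler_suml; apply: eq_bigr => s _; rewrite big_mmul_fmonom.
Qed.

(** Comparison of coefficients: distinct [mu] give distinct monomials since [concat] is injective.
    The same [A] serves in both directions. *)
Lemma nc_waringP delta d t (p : {ncpoly K[I]}) : nchomog (delta * d) p ->
  nc_waring delta d t p <->
  exists A : 'I_t -> delta.-tuple I -> K,
    forall mu : d.-tuple (delta.-tuple I),
      nccoef p mu = \sum_(s < t) \prod_(b <- mu) A s b.
Proof.
move=> hp; split=> -[A E]; exists A; last first.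
  rewrite sum_exp_ncmon (homog_expansion hp).
  by apply: eq_bigr => mu _; rewrite E.
move: E; rewrite sum_exp_ncmon {1}(homog_expansion hp).
by apply: sum_monom_inj => mu nu [] /concat_inj.
Qed.

Lemma sum_exp_cX d t (A : 'I_t -> I -> K) :
  \sum_(s < t) (\sum_(i : I) A s i *: cX K i) ^+ d
  = \sum_(mu : d.-tuple I) (\sum_(s < t) \prod_(b <- mu) A s b)
      *: << \big[mmul/mone]_(i <- mu) ucm i >>.
Proof.
under eq_bigr => s _ do rewrite exp_sum_monom.
rewrite exchange_big; apply: eq_bigr => mu _ /=.
by rewrite scaler_suml.
Qed.

Lemma collapse_sum_ncmon d (c : d.-tuple I -> K) :
  collapse (\sum_mu c mu *: ncmon K mu)
  = \sum_mu c mu *: << \big[mmul/mone]_(i <- mu) ucm i >>.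
Proof.
set h := fun m : {fmonom I} => \prod_(i <- (m : seq I)) cX K i.
(* As a sum over the support of its argument, [collapse] is not visibly additive; written as [mmap],
   it is. *)
have mmapcE q : collapse q = mmap malgC h q.
  by apply: eq_bigr => m _; rewrite mul_malgC.
rewrite mmapcE raddf_sum; apply: eq_bigr => mu _ /=.
by rewrite ncmonE !scale_monom mmapU mul_malgC /h prod_monom scale_monom.
Qed.

End Waring.

Lemma phi_coef (K : fieldType) (g delta d : nat) (p : {ncpoly K['I_g]})
    (mu : d.-tuple (delta.-tuple 'I_g)) :
  (phi delta d p)@_(FMonom mu) = nccoef p mu.
Proof.
rewrite /phi; under eq_bigr do rewrite ncmonE.
by rewrite mcoeff_sum_monom (big_pred1 mu).
Qed.

Theorem theorem4p9 (R : realType) (K : fieldType)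
  (hK : K = R :> fieldType \/ K = complex R :> fieldType)
  (g delta d t : nat)
  (hg : (1 <= g)%N) (hdelta : (1 <= delta)%N) (hd : (1 <= d)%N)
  (ht : (1 <= t)%N)
  (p : {ncpoly K['I_g]}) (hp : nchomog (delta * d) p) :
  [/\ (nc_waring delta d t p <-> nc_waring 1 d t (phi delta d p)),
      (compatible delta d p <-> compatible 1 d (phi delta d p)) &
      (nc_waring delta d t p <->
        compatible delta d p /\ c_waring d t (collapse (phi delta d p)))].
Proof.
have K0 : [pchar K] =i pred0.
  by case: hK => ->; apply: pchar_num.
have prod_sym (A : 'I_t -> delta.-tuple 'I_g -> K)
    (mu nu : d.-tuple (delta.-tuple 'I_g)) : perm_eq mu nu ->
    \sum_(s < t) \prod_(b <- mu) A s b = \sum_(s < t) \prod_(b <- nu) A s b.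
  by move=> mu_nu; apply: eq_bigr => s _; apply: perm_big.
have permE (mu nu : d.-tuple (delta.-tuple 'I_g)) :
    (forall b, count_mem b mu = count_mem b nu) <-> perm_eq mu nu.
  split=> [E|/permP E b]; last exact: E.
  by apply/allP => b _; rewrite /= E.
have phiE : phi delta d p = \sum_(mu : d.-tuple (delta.-tuple 'I_g))
    nccoef p mu *: << FMonom mu >>.
  by apply: eq_bigr => mu _; rewrite ncmonE.
split.
(* Linear forms in the [z_b] are indexed by 1-tuples of blocks; [nc_waring1P] reindexes them by the
   blocks themselves, so one family [A] fits [p] and its image. *)
- rewrite nc_waring1P (nc_waringP _ hp).
  have expand (A : 'I_t -> delta.-tuple 'I_g -> K) :
      \sum_(s < t) (\sum_b A s b *: ncX K b) ^+ d
      = \sum_(mu : d.-tuple (delta.-tuple 'I_g))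
          (\sum_(s < t) \prod_(b <- mu) A s b) *: << FMonom mu >>.
    under eq_bigr => s _ do rewrite exp_sum_monom.
    rewrite exchange_big; apply: eq_bigr => mu _ /=.
    rewrite -scaler_suml; congr (_ *: << _ >>).
    under eq_bigr do rewrite fmuE.
    rewrite (big_mmul_fmonom (fun b => [:: b])).
    by congr FMonom; elim: (val mu) => //= b s ->.
  split=> -[A E]; exists A; rewrite ?expand ?phiE.
    by apply: eq_bigr => mu _; rewrite E.
  move: E; rewrite expand phiE; apply: sum_monom_inj => mu nu [].
  exact: val_inj.
- rewrite compatible1P; split=> H mu nu E; have := H mu nu E;
    by rewrite !phi_coef.
- rewrite (nc_waringP _ hp); split=> [[A E]|[c_sym [A]]].
    split; first by move=> mu nu /permE/prod_sym H; rewrite !E.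
    exists A; rewrite sum_exp_cX /phi collapse_sum_ncmon.
    by apply: eq_bigr => mu _; rewrite E.
  (* The forms of the commutative decomposition also decompose [p]: both coefficient families are
     constant on rearrangement classes, one by compatibility and the other by symmetry of
     products. *)
  rewrite sum_exp_cX /phi collapse_sum_ncmon => E; exists A.
  apply: (sum_monom_fiber_inj K0 _ _ E) => mu nu /eqP; rewrite eq_big_mmul_ucm.
    by move=> /permE; apply: c_sym.
  exact: prod_sym.
Qed.
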